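(* Let $\mathcal{F}$ be a discourse sheaf on a finite graph $G=(V,E)$, $x\in C^0(G;\mathcal{F})$ a fixed $0$-cochain, $\mathcal{I}$ a set of adapting incidences, $\mathcal{H}^x$ the sheaf of structures, $\mathcal{H}^x_{\mathcal{I}}$ the sheaf of free structures, and $A$, $c$ the discrepancy operator and constant. Under the identification $V_{\mathrm{maps}}\cong C^0(G;\mathcal{H}^x_{\mathcal{I}})$: 1. The coboundary of $\mathcal{H}^x_{\mathcal{I}}$ coincides with the discrepancy operator: $\delta^{\mathcal{H}^x_{\mathcal{I}}}=A$. 2. The Laplacian of $\mathcal{H}^x_{\mathcal{I}}$ is $L_{\mathcal{H}^x_{\mathcal{I}}}=A^TA$. 3. The term $c$ arises from the stubborn configuration: $c_e=(\delta^{\mathcal{H}^x}\tilde\sigma_0)_e$ for each $e\in E'$, where $\tilde\sigma_0=\iota_{S^{\mathcal{H}}}(\sigma_0)\in C^0(G;\mathcal{H}^x)$ is the embedding of the fixed restriction maps $\sigma_0=(\mathcal{F}_{w\unlhd e})_{(w,e)\notin\mathcal{I}}$ (zero in the components indexed by $\mathcal{I}$).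
   Context: A discourse sheaf (cellular sheaf) $\mathcal{F}$ on $G$ assigns finite-dimensional real inner product spaces $\mathcal{F}(v)$, $\mathcal{F}(e)$ to vertices and edges and a linear restriction map $\mathcal{F}_{v\unlhd e}:\mathcal{F}(v)\to\mathcal{F}(e)$ to each incidence $v\in e$ (written $v\unlhd e$). For any cellular sheaf $\mathcal{G}$, $C^0(G;\mathcal{G})=\bigoplus_v\mathcal{G}(v)$, $C^1(G;\mathcal{G})=\bigoplus_e\mathcal{G}(e)$ with direct-sum inner products; for a fixed orientation of all edges, for $e=u\to v$, $(\delta^{\mathcal{G}}z)_e=\mathcal{G}_{v\unlhd e}(z_v)-\mathcal{G}_{u\unlhd e}(z_u)$, and $L_{\mathcal{G}}=(\delta^{\mathcal{G}})^*\delta^{\mathcal{G}}$. Let $\mathcal{I}\subseteq\{(v,e):v\unlhd e\}$; $V_{\mathrm{maps}}=\bigoplus_{(v,e)\in\mathcal{I}}\mathrm{Hom}(\mathcal{F}(v),\mathcal{F}(e))$ with Frobenius inner product; $E'$ is the set of edges with at least one incidence in $\mathcal{I}$; $W=\bigoplus_{e\in E'}\mathcal{F}(e)$. With $\sigma_{w,e}=+1$ if $w$ is the head of $e$, $-1$ if the tail, define $A:V_{\mathrm{maps}}\to W$ and $c\in W$ by $(A\rho)_e=\sum_{(w,e)\in\mathcal{I}}\sigma_{w,e}\rho_{w\unlhd e}(x_w)$ and $c_e=\sum_{(w,e)\notin\mathcal{I}}\sigma_{w,e}\mathcal{F}_{w\unlhd e}(x_w)$ (sums over the endpoints $w$ of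 $e\in E'$). Sheaf of structures $\mathcal{H}^x$: vertex stalks $\mathcal{H}^x(v)=\bigoplus_{e:v\unlhd e}\mathrm{Hom}(\mathcal{F}(v),\mathcal{F}(e))$ (Frobenius inner product), edge stalks $\mathcal{H}^x(e)=\mathcal{F}(e)$, restriction maps $(\mathcal{H}^x)_{v\unlhd e}(\rho)=\rho_{v\unlhd e}(x_v)$ for $\rho=(\rho_{v\unlhd e'})_{e'}$. Decompose $\mathcal{H}^x(v)=S_v^{\mathcal{H}}\oplus T_v^{\mathcal{H}}$ with $S_v^{\mathcal{H}}=\bigoplus_{e:(v,e)\notin\mathcal{I}}\mathrm{Hom}(\mathcal{F}(v),\mathcal{F}(e))$ (over $e\ni v$) and $T_v^{\mathcal{H}}=\bigoplus_{e:(v,e)\in\mathcal{I}}\mathrm{Hom}(\mathcal{F}(v),\mathcal{F}(e))$; $\iota_{S^{\mathcal{H}}}:\bigoplus_vS^{\mathcal{H}}_v\hookrightarrow C^0(G;\mathcal{H}^x)$ is the inclusion. Sheaf of free structures $\mathcal{H}^x_{\mathcal{I}}$: vertex stalks $T_v^{\mathcal{H}}$, edge stalks $\mathcal{F}(e)$ for $e\in E'$ and $0$ for $e\notin E'$, restriction maps inherited from $\mathcal{H}^x$. Thus $C^0(G;\mathcal{H}^x_{\mathcal{I}})=\bigoplus_vT_v^{\mathcal{H}}=V_{\mathrm{maps}}$ and $C^1(G;\mathcal{H}^x_{\mathcal{I}})=W$. *)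

(* Defs.v *)
From HB Require Import structures.
From mathcomp Require Import all_boot all_order all_algebra.
From mathcomp Require Import reals.

Set Implicit Arguments.
Unset Strict Implicit.
Unset Printing Implicit Defensive.

Import Order.TTheory GRing.Theory Num.Theory.
Import VectorInternalTheory.
Local Open Scope ring_scope.

Record euclid (R : realType) := Euclid {
  euclid_space :> vectType R;
  inner : {dot euclid_space for idfun} }.

Section Inner.
Variables (R : realType) (U : euclid R).
Implicit Types u v w : U.

Lemma innerC u v : inner U u v = inner U v u.
Proof. by rewrite hermC /= expr0 mul1r. Qed.

Lemma inner_gt0 u : u != 0 -> 0 < inner U u u.
Proof. exact: neq0_dnorm_gt0. Qed.

Lemma inner_ge0 u : 0 <= inner U u u.
Proof. by have [->|/inner_gt0/ltW//] := eqVneq u 0; rewrite linear0r. Qed.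

Lemma inner_eq0 u : (inner U u u == 0) = (u == 0).
Proof.
have [->|un0] := eqVneq u 0; first by rewrite linear0r eqxx.
by rewrite gt_eqF // inner_gt0.
Qed.

Lemma inner_linearl w : linear_for *%R (fun u => inner U u w).
Proof. by move=> a u v; rewrite !(innerC _ w) linearP. Qed.

Lemma inner_inj u v : (forall w, inner U u w = inner U v w) -> u = v.
Proof.
move=> uv; apply/eqP; rewrite -subr_eq0 -inner_eq0 linearB /= subr_eq0.
by rewrite innerC uv innerC.
Qed.

End Inner.

Section Adjoint.
Variable R : realType.

Section Riesz.
Variable U : euclid R.

Definition riesz_fun (u : U) : 'Hom(U, R^o) := linfun (inner U u : U -> R^o).

Lemma riesz_funE u w : riesz_fun u w = inner U u w.
Proof. exact: lfunE. Qed.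

Fact riesz_is_linear : linear riesz_fun.
Proof.
move=> a u v; apply/lfunP => w; rewrite !lfunE /= lfunE /= !riesz_funE.
exact: inner_linearl.
Qed.
HB.instance Definition _ := GRing.isLinear.Build R _ _ _ riesz_fun riesz_is_linear.

Definition riesz : 'Hom(U, 'Hom(U, R^o)) := linfun riesz_fun.

Lemma rieszE u w : riesz u w = inner U u w.
Proof. by rewrite lfunE riesz_funE. Qed.

Lemma riesz_lker0 : lker riesz == 0%VS.
Proof.
apply/lker0P => u v uv; apply: inner_inj => w.
by rewrite -!rieszE uv.
Qed.

Lemma riesz_invK phi : riesz ((riesz^-1)%VF phi) = phi.
Proof.
apply: limg_lfunVK; suff -> : limg riesz = fullv by rewrite memvf.
apply/eqP; rewrite eqEdim subvf /= limg_dim_eq; last first.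
  by rewrite (eqP riesz_lker0) capv0.
by rewrite !dimvf /dim /= muln1.
Qed.

End Riesz.

Variables U V : euclid R.

(* The adjoint obtained from the Riesz isomorphisms u |-> <u, _>; see adjointP
   and adjoint_uniq. *)
Definition adjoint_fun (f : 'Hom(U, V)) (v : V) : U :=
  ((riesz U)^-1)%VF (riesz V v \o f)%VF.

Lemma adjoint_funP (f : 'Hom(U, V)) v u : inner U (adjoint_fun f v) u = inner V v (f u).
Proof. by rewrite -rieszE riesz_invK lfunE /= rieszE. Qed.

Fact adjoint_fun_is_linear (f : 'Hom(U, V)) : linear (adjoint_fun f).
Proof.
move=> a v w; apply: inner_inj => u.
by rewrite adjoint_funP !inner_linearl !adjoint_funP.
Qed.
HB.instance Definition _ f :=
  GRing.isLinear.Build R _ _ _ (adjoint_fun f) (adjoint_fun_is_linear f).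

Definition adjoint (f : 'Hom(U, V)) : 'Hom(V, U) := linfun (adjoint_fun f).

Lemma adjointP (f : 'Hom(U, V)) v u : inner U (adjoint f v) u = inner V v (f u).
Proof. by rewrite lfunE adjoint_funP. Qed.

Lemma adjoint_uniq (f : 'Hom(U, V)) (g : 'Hom(V, U)) :
  (forall v u, inner U (g v) u = inner V v (f u)) -> g = adjoint f.
Proof.
move=> gP; apply/lfunP => v; apply: inner_inj => u.
by rewrite gP adjointP.
Qed.

Fact adjoint_is_linear : linear adjoint.
Proof.
move=> a f g; apply/esym/adjoint_uniq => v u.
have DE : forall (W Z : vectType R) (h k : 'Hom(W, Z)) w,
  (a *: h + k) w = a *: h w + k w by move=> *; rewrite lfunE /= lfunE.
by rewrite !DE inner_linearl !adjointP linearP.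
Qed.
HB.instance Definition _ := GRing.isLinear.Build R _ _ _ adjoint adjoint_is_linear.

End Adjoint.

Section Frobenius.
Variable R : realType.

Definition ltrace (U : vectType R) (h : 'End(U)) : R :=
  \tr (passmx.mxof (vbasis {:U}) (vbasis {:U}) h).

Definition orthonormal_basis (U : euclid R) (b : (\dim {:U}).-tuple U) :=
  forall i j : 'I_(\dim {:U}), inner U b`_i b`_j = (i == j)%:R.

Section Basis.
Variable U : euclid R.

Lemma exists_orthonormal_basis :
  exists b : (\dim {:U}).-tuple U, orthonormal_basis b.
Proof.
suff H n : (n <= \dim {:U})%N -> exists2 s : n.-tuple U, True &
    forall i j : 'I_n, inner U s`_i s`_j = (i == j)%:R.
  by have [b _ bP] := H _ (leqnn _); exists b.
elim: n => [_|n IHn ltn]; first by exists [tuple] => // -[].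
have [s _ sP] := IHn (ltnW ltn).
have /subvPn [v _ vs] : ~~ ({:U} <= <<s>>)%VS.
  apply: contraTN ltn => /dimvS; rewrite -leqNgt => /leq_trans; apply.
  by rewrite (leq_trans (dim_span _)) // size_tuple.
pose w := v - \sum_(i < n) inner U v s`_i *: s`_i.
have wn0 : w != 0.
  apply: contraNneq vs => /eqP; rewrite subr_eq0 => /eqP ->.
  by apply: memv_suml => i _; rewrite memvZ // memv_span // mem_nth // size_tuple.
have ws (j : 'I_n) : inner U w s`_j = 0.
  rewrite /w innerC linearB /= linear_sum /= (bigD1 j) //= big1 ?addr0.
    by rewrite linearZ /= sP eqxx mulr1 innerC subrr.
  by move=> i ij; rewrite linearZ /= sP eq_sym (negPf ij) mulr0.
pose c := Num.sqrt (inner U w w).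
have cn0 : c != 0 by rewrite gt_eqF // sqrtr_gt0 inner_gt0.
have cc : c * c = inner U w w by rewrite -expr2 sqr_sqrtr ?inner_ge0.
have ccw : inner U (c^-1 *: w) (c^-1 *: w) = 1.
  rewrite linearZ /= innerC linearZ /= -cc.
  by rewrite [X in _ * X]mulrA mulVf // mul1r mulVf.
have cws (j : 'I_n) : inner U (c^-1 *: w) s`_j = 0.
  by rewrite innerC linearZ /= innerC ws mulr0.
exists [tuple of c^-1 *: w :: s] => // i j.
case: (unliftP ord0 i) => [i'|] ->; case: (unliftP ord0 j) => [j'|] -> //=.
- by rewrite sP (inj_eq (@lift_inj _ _)).
- by rewrite innerC cws.
- exact: cws.
Qed.

Lemma orthonormal_expand (b : (\dim {:U}).-tuple U) : orthonormal_basis b ->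
  forall u, u = \sum_(i < \dim {:U}) inner U u b`_i *: b`_i.
Proof.
move=> bP u.
have bfree : free b.
  apply/freeP => k k0 i.
  have := congr1 (inner U b`_i) k0; rewrite linear0r linear_sum (bigD1 i) //=.
  rewrite linearZ /= bP eqxx mulr1 big1 ?addr0 // => j ji.
  by rewrite linearZ /= bP eq_sym (negPf ji) mulr0.
have bbasis : basis_of {:U} b by rewrite basisEfree bfree subvf size_tuple /=.
rewrite {1}(coord_basis bbasis (memvf u)); apply: eq_bigr => i _.
congr (_ *: _); rewrite {2}(coord_basis bbasis (memvf u)).
rewrite innerC linear_sum (bigD1 i) //= linearZ /= bP eqxx mulr1 big1 ?addr0 //.
by move=> j ji; rewrite linearZ /= bP eq_sym (negPf ji) mulr0.
Qed.

Lemma ltraceE (b : (\dim {:U}).-tuple U) (h : 'End(U)) : orthonormal_basis b ->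
  ltrace h = \sum_(i < \dim {:U}) inner U b`_i (h b`_i).
Proof.
move=> bP; set e := vbasis {:U}.
have eP : basis_of {:U} e := vbasisP _.
have -> : ltrace h = \sum_(i < \dim {:U}) coord e i (h e`_i).
  by apply: eq_bigr => i _; rewrite mxE /= mxE passmx.vecof_delta.
under eq_bigr => i _ do rewrite (orthonormal_expand bP (h _)) linear_sum.
rewrite exchange_big; apply: eq_bigr => j _ /=.
have hb : h b`_j = \sum_(i < \dim {:U}) coord e i b`_j *: h e`_i.
  rewrite {1}(coord_basis eP (memvf b`_j)) linear_sum.
  by apply: eq_bigr => i _; rewrite linearZ.
rewrite hb linear_sum; apply: eq_bigr => i _.
by rewrite !linearZ /= mulrC [inner U _ _]innerC.
Qed.

End Basis.

Variables U V : euclid R.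

Definition frobenius (f g : 'Hom(U, V)) : R := ltrace (adjoint f \o g)%VF.

Lemma frobeniusE (b : (\dim {:U}).-tuple U) f g : orthonormal_basis b ->
  frobenius f g = \sum_(i < \dim {:U}) inner V (f b`_i) (g b`_i).
Proof.
move=> bP; rewrite /frobenius (ltraceE _ bP); apply: eq_bigr => i _.
by rewrite lfunE /= innerC adjointP innerC.
Qed.

Fact frobenius_is_bilinear : bilinear_for *%R (idfun \; *%R) frobenius.
Proof.
have [b bP] := exists_orthonormal_basis U.
split=> h a f g; rewrite !(frobeniusE _ _ bP) /= mulr_sumr -big_split /=.
  by apply: eq_bigr => i _; rewrite lfunE /= lfunE /= inner_linearl.
by apply: eq_bigr => i _; rewrite lfunE /= lfunE /= linearP.
Qed.

Fact frobenius_is_hermitian f g :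
  frobenius f g = (-1) ^+ false * idfun (frobenius g f).
Proof.
have [b bP] := exists_orthonormal_basis U.
rewrite expr0 mul1r /= !(frobeniusE _ _ bP).
by apply: eq_bigr => i _; rewrite innerC.
Qed.

Fact frobenius_gt0 f : f != 0 -> 0 < frobenius f f.
Proof.
have [b bP] := exists_orthonormal_basis U.
have f_ge0 : 0 <= frobenius f f.
  by rewrite (frobeniusE _ _ bP) sumr_ge0 // => i _; apply: inner_ge0.
rewrite lt_def f_ge0 andbT; apply: contra_neq => f0.
have fb (i : 'I_(\dim {:U})) : f b`_i = 0.
  apply/eqP; rewrite -inner_eq0; move/eqP: f0; rewrite (frobeniusE _ _ bP).
  by rewrite psumr_eq0 => [/allP /(_ i (mem_index_enum _))//|j _]; exact: inner_ge0.
apply/lfunP => u; rewrite (orthonormal_expand bP u) linear_sum zero_lfunE big1 // => i _.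
by rewrite /= linearZ /= fb scaler0.
Qed.

HB.instance Definition _ := bilinear_isBilinear.Build R _ _ _ *%R (idfun \; *%R)
  frobenius frobenius_is_bilinear.
HB.instance Definition _ := isHermitianSesquilinear.Build R _ false idfun frobenius
  frobenius_is_hermitian.
HB.instance Definition _ := isDotProduct.Build R _ frobenius frobenius_gt0.

Definition hom_space : euclid R := Euclid (frobenius : {dot _ for idfun}).

End Frobenius.

Section DirectSum.
Variables (R : realType) (J : finType) (V : J -> euclid R).

Definition dsum_vect := {dffun forall j, V j}.
Implicit Types (a : R) (z w : dsum_vect).

HB.instance Definition _ := Choice.on dsum_vect.

Definition dsum_of (f : forall j, V j) : dsum_vect := [ffun j => f j].

Lemma dsum_ofE f j : dsum_of f j = f j. Proof. by rewrite ffunE. Qed.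

Lemma dsumP z w : (forall j, z j = w j) -> z = w.
Proof. by move=> zw; apply/ffunP. Qed.

Definition dsum_zero := dsum_of (fun=> 0).
Definition dsum_opp z := dsum_of (fun j => - z j).
Definition dsum_add z w := dsum_of (fun j => z j + w j).
Definition dsum_scale a z := dsum_of (fun j => a *: z j).

Fact dsum_addA : associative dsum_add.
Proof. by move=> x y z; apply: dsumP => j; rewrite !dsum_ofE addrA. Qed.
Fact dsum_addC : commutative dsum_add.
Proof. by move=> x y; apply: dsumP => j; rewrite !dsum_ofE addrC. Qed.
Fact dsum_add0 : left_id dsum_zero dsum_add.
Proof. by move=> x; apply: dsumP => j; rewrite !dsum_ofE add0r. Qed.
Fact dsum_addN : left_inverse dsum_zero dsum_opp dsum_add.
Proof. by move=> x; apply: dsumP => j; rewrite !dsum_ofE addNr. Qed.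
HB.instance Definition _ := GRing.isZmodule.Build dsum_vect
  dsum_addA dsum_addC dsum_add0 dsum_addN.

Fact dsum_scaleA a b z : dsum_scale a (dsum_scale b z) = dsum_scale (a * b) z.
Proof. by apply: dsumP => j; rewrite !dsum_ofE scalerA. Qed.
Fact dsum_scale1 : left_id 1 dsum_scale.
Proof. by move=> z; apply: dsumP => j; rewrite !dsum_ofE scale1r. Qed.
Fact dsum_scaleDr : right_distributive dsum_scale +%R.
Proof. by move=> a z w; apply: dsumP => j; rewrite !dsum_ofE scalerDr. Qed.
Fact dsum_scaleDl z : {morph dsum_scale^~ z : a b / a + b}.
Proof. by move=> a b; apply: dsumP => j; rewrite !dsum_ofE scalerDl. Qed.
HB.instance Definition _ := GRing.Zmodule_isLmodule.Build R dsum_vect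
  dsum_scaleA dsum_scale1 dsum_scaleDr dsum_scaleDl.

Lemma dsum_linE a z w j : (a *: z + w) j = a *: z j + w j.
Proof. by rewrite !dsum_ofE. Qed.

Let coord_index := {j : J & 'I_(dim (V j))}.

Fact dsum_vect_axiom : Vector.axiom #|{: coord_index}| dsum_vect.
Proof.
exists (fun z => \row_k v2r (z (tag (enum_val k))) 0 (tagged (enum_val k))).
  by move=> a z w; apply/rowP => k; rewrite !mxE dsum_linE linearP !mxE.
exists (fun r : 'rV_ _ => dsum_of (fun j =>
  r2v (\row_k r 0 (enum_rank (Tagged (fun j => 'I_(dim (V j))) k))))) => [z|r].
  apply: dsumP => j; rewrite dsum_ofE; apply: (can_inj v2rK); rewrite r2vK.
  by apply/rowP => k; rewrite !mxE enum_rankK.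
apply/rowP => k; rewrite mxE dsum_ofE r2vK mxE; congr (r 0 _).
by apply: enum_val_inj; rewrite enum_rankK; case: (enum_val k).
Qed.
HB.instance Definition _ := Lmodule_hasFinDim.Build R dsum_vect dsum_vect_axiom.

Definition dsum_inner z w : R := \sum_j inner (V j) (z j) (w j).

Fact dsum_inner_is_bilinear : bilinear_for *%R (idfun \; *%R) dsum_inner.
Proof.
split=> u a z w; rewrite /dsum_inner /= mulr_sumr -big_split /=.
  by apply: eq_bigr => j _; rewrite dsum_linE inner_linearl.
by apply: eq_bigr => j _; rewrite dsum_linE linearP.
Qed.

Fact dsum_inner_is_hermitian z w :
  dsum_inner z w = (-1) ^+ false * idfun (dsum_inner w z).
Proof. by rewrite expr0 mul1r; apply: eq_bigr => j _; rewrite innerC. Qed.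

Fact dsum_inner_gt0 z : z != 0 -> 0 < dsum_inner z z.
Proof.
have z_ge0 : 0 <= dsum_inner z z by rewrite sumr_ge0 // => j _; apply: inner_ge0.
rewrite lt_def z_ge0 andbT; apply: contra_neq => /eqP.
rewrite psumr_eq0 => [/allP z0|j _]; last exact: inner_ge0.
apply: dsumP => j; apply/eqP; rewrite dsum_ofE -inner_eq0.
exact: z0 j (mem_index_enum _).
Qed.

HB.instance Definition _ := bilinear_isBilinear.Build R _ _ _ *%R (idfun \; *%R)
  dsum_inner dsum_inner_is_bilinear.
HB.instance Definition _ := isHermitianSesquilinear.Build R _ false idfun
  dsum_inner dsum_inner_is_hermitian.
HB.instance Definition _ := isDotProduct.Build R _ dsum_inner dsum_inner_gt0.

Definition dsum : euclid R := Euclid (dsum_inner : {dot _ for idfun}).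

End DirectSum.

Section LinearMaps.
Variable R : realType.

Section ProjLprod.
Variables (J : finType) (V : J -> euclid R) (U : euclid R).

Definition proj_fun j (z : dsum V) : V j := (z : dsum_vect V) j.
Fact proj_fun_is_linear j : linear (proj_fun j).
Proof. by move=> a z w; rewrite /proj_fun dsum_linE. Qed.
HB.instance Definition _ j :=
  GRing.isLinear.Build R _ _ _ (proj_fun j) (proj_fun_is_linear j).

Definition proj j : 'Hom(dsum V, V j) := linfun (proj_fun j).

Lemma projE j (z : dsum V) : proj j z = (z : dsum_vect V) j.
Proof. exact: lfunE. Qed.

Definition tuple_fun (f : forall j, 'Hom(U, V j)) (u : U) : dsum V :=
  dsum_of (fun j => f j u).
Fact tuple_fun_is_linear f : linear (tuple_fun f).
Proof. by move=> a u v; apply: dsumP => j; rewrite dsum_linE !dsum_ofE linearP. Qed.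
HB.instance Definition _ f :=
  GRing.isLinear.Build R _ _ _ (tuple_fun f) (tuple_fun_is_linear f).

Definition tuple_map (f : forall j, 'Hom(U, V j)) : 'Hom(U, dsum V) :=
  linfun (tuple_fun f).

Lemma tuple_mapE f u j : (tuple_map f u : dsum_vect V) j = f j u.
Proof. by rewrite lfunE /= dsum_ofE. Qed.

End ProjLprod.

Section EvalAt.
Variables (U V : euclid R) (x : U).

Definition eval_fun (f : hom_space U V) : V := (f : 'Hom(U, V)) x.
Fact eval_fun_is_linear : linear eval_fun.
Proof. by move=> a f g; rewrite /eval_fun !lfunE /= lfunE. Qed.
HB.instance Definition _ := GRing.isLinear.Build R _ _ _ eval_fun eval_fun_is_linear.

Definition eval_at : 'Hom(hom_space U V, V) := linfun eval_fun.

Lemma eval_atE f : eval_at f = (f : 'Hom(U, V)) x.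
Proof. exact: lfunE. Qed.

End EvalAt.

(* The inclusion of a sub-sum (by zero outside P) when P is contained in Q. *)
Definition extend0 (J : finType) (P Q : pred J) (V : J -> euclid R) :
    'Hom(dsum (fun j : {j | P j} => V (sval j)),
         dsum (fun j : {j | Q j} => V (sval j))) :=
  tuple_map (fun j : {j | Q j} =>
    match boolP (P (sval j)) with
    | AltTrue Pj => proj (fun j : {j | P j} => V (sval j)) (exist _ (sval j) Pj)
    | AltFalse _ => 0
    end).

(* The zero space, as the empty direct sum. *)
Definition zero_space : euclid R := dsum (of_void (euclid R)).

End LinearMaps.
Arguments proj {R J V}.
Arguments eval_at {R U V}.
Arguments extend0 {R J}.
Arguments zero_space {R}.

Section DirectSumTheory.
Variable R : realType.

Lemma innerE (J : finType) (V : J -> euclid R) (z w : dsum V) :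
  inner (dsum V) z w = \sum_j inner (V j) (proj j z) (proj j w).
Proof. by apply: eq_bigr => j _; rewrite !projE. Qed.

Lemma proj_tuple (U : euclid R) (J : finType) (V : J -> euclid R)
  (f : forall j, 'Hom(U, V j)) u j : proj j (tuple_map f u) = f j u.
Proof. by rewrite projE tuple_mapE. Qed.

Lemma proj_of (J : finType) (V : J -> euclid R) (f : forall j, V j) j :
  proj j (dsum_of f : dsum V) = f j.
Proof. by rewrite projE dsum_ofE. Qed.

End DirectSumTheory.

Lemma sum_sig (R : nmodType) (J : finType) (P : pred J) (f : {j | P j} -> R) :
  \sum_i f i = \sum_j match boolP (P j) with
                      | AltTrue Pj => f (exist _ j Pj)
                      | AltFalse _ => 0
                      end.
Proof.
rewrite [RHS](bigID P) /= [X in _ + X]big1 ?addr0 => [|j /negP nPj]; last first.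
  by case: {-}_ / boolP.
rewrite (reindex_omap (J := {j | P j}) sval insub) => [|j Pj]; last by rewrite insubT.
apply: eq_big => [[j Pj]|[j Pj] _] /=.
  by rewrite Pj insubT /= eqxx.
case: {-}_ / boolP => [Pj'|/negP//].
by congr f; apply: val_inj.
Qed.

(* Parallel edges are allowed; loops are not, since the sign of an incidence
   (head or tail) would be ill-defined. *)
Record graph := Graph {
  vert : finType;
  edge : finType;
  ends : edge -> {set vert};
  card_ends : forall e, #|ends e| = 2%N }.

Record orientation (G : graph) := Orientation {
  etail : edge G -> vert G;
  ehead : edge G -> vert G;
  endsE : forall e, ends e = [set etail e; ehead e] }.

Lemma tail_end (G : graph) (o : orientation G) e : etail o e \in ends e.
Proof. by rewrite (endsE o) set21. Qed.

Lemma head_end (G : graph) (o : orientation G) e : ehead o e \in ends e.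
Proof. by rewrite (endsE o) set22. Qed.

Record sheaf (R : realType) (G : graph) := Sheaf {
  vstalk : vert G -> euclid R;
  estalk : edge G -> euclid R;
  restr : forall v e, v \in ends e -> 'Hom(vstalk v, estalk e) }.

Section Sheaf.
Variables (R : realType) (G : graph) (o : orientation G).

Definition C0 (F : sheaf R G) : euclid R := dsum (vstalk F).
Definition C1 (F : sheaf R G) : euclid R := dsum (estalk F).

Definition coboundary (F : sheaf R G) : 'Hom(C0 F, C1 F) :=
  tuple_map (fun e => (restr F (head_end o e) \o proj (ehead o e))%VF
                    - (restr F (tail_end o e) \o proj (etail o e))%VF).

Definition laplacian (F : sheaf R G) : 'End(C0 F) :=
  (adjoint (coboundary F) \o coboundary F)%VF.

Definition incidence_sign (w : vert G) (e : edge G) : R :=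
  if w == ehead o e then 1 else if w == etail o e then -1 else 0.

Variables (F : sheaf R G) (x : C0 F) (I : {set vert G * edge G}).

Definition adapting_edges : {set edge G} := [set e | [exists v, (v, e) \in I]].

(* I is meant to be a set of incidences: (v, e) \in I -> v \in ends e. *)
Definition Vmaps : euclid R :=
  dsum (fun i : {i | i \in I} => hom_space (vstalk F (sval i).1) (estalk F (sval i).2)).

Definition Vmaps_at w e (we : (w, e) \in I) :
    'Hom(Vmaps, hom_space (vstalk F w) (estalk F e)) :=
  proj (exist (fun i => i \in I) (w, e) we).

Definition Wspace : euclid R :=
  dsum (fun e : {e | e \in adapting_edges} => estalk F (sval e)).

Definition Wspace_at e (Ee : e \in adapting_edges) : 'Hom(Wspace, estalk F e) :=
  proj (exist (fun e => e \in adapting_edges) e Ee).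

Definition discrepancy_op : 'Hom(Vmaps, Wspace) :=
  tuple_map (U := Vmaps) (fun e : {e | e \in adapting_edges} =>
    \sum_(w : {w | (w, sval e) \in I}) incidence_sign (sval w) (sval e) *:
      (eval_at (proj (sval w) x) \o Vmaps_at (proj2_sig w))%VF).

Definition discrepancy_const : Wspace :=
  dsum_of (fun e : {e | e \in adapting_edges} =>
    \sum_(w : {w | w \in ends (sval e)} | (sval w, sval e) \notin I)
      incidence_sign (sval w) (sval e) *: restr F (proj2_sig w) (proj (sval w) x)).

Definition structure_sheaf : sheaf R G := {|
  vstalk := fun v =>
    dsum (fun e : {e | v \in ends e} => hom_space (vstalk F v) (estalk F (sval e)));
  estalk := estalk F;
  restr := fun v e ve => (eval_at (proj v x) \o proj (exist _ e ve))%VF |}.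

Definition S_stalk (v : vert G) : euclid R :=
  dsum (fun e : {e | (v \in ends e) && ((v, e) \notin I)} =>
    hom_space (vstalk F v) (estalk F (sval e))).

Definition T_stalk (v : vert G) : euclid R :=
  dsum (fun e : {e | (v, e) \in I} => hom_space (vstalk F v) (estalk F (sval e))).

Definition S_incl : 'Hom(dsum S_stalk, C0 structure_sheaf) :=
  tuple_map (fun v =>
    (extend0 (fun e => (v \in ends e) && ((v, e) \notin I)) (fun e => v \in ends e)
       (fun e => hom_space (vstalk F v) (estalk F e)) \o proj v)%VF).

Definition T_incl (v : vert G) : 'Hom(T_stalk v, vstalk structure_sheaf v) :=
  extend0 (fun e => (v, e) \in I) (fun e => v \in ends e)
    (fun e => hom_space (vstalk F v) (estalk F e)).

Definition free_estalk (e : edge G) : euclid R :=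
  if e \in adapting_edges then estalk F e else zero_space.

Definition to_free_estalk (e : edge G) : 'Hom(estalk F e, free_estalk e) :=
  if e \in adapting_edges as b
    return 'Hom(estalk F e, if b then estalk F e else zero_space)
  then \1%VF else 0.

Definition free_sheaf : sheaf R G := {|
  vstalk := T_stalk;
  estalk := free_estalk;
  restr := fun v e ve =>
    (to_free_estalk e \o restr structure_sheaf ve \o T_incl v)%VF |}.

Definition fixed_maps : dsum S_stalk :=
  dsum_of (V := S_stalk) (fun v => dsum_of
    (V := fun e : {e | (v \in ends e) && ((v, e) \notin I)} =>
       hom_space (vstalk F v) (estalk F (sval e)))
    (fun e => restr F (proj1 (andP (proj2_sig e))))).

Definition Vmaps_to_C0 : 'Hom(Vmaps, C0 free_sheaf) :=
  tuple_map (V := T_stalk) (fun v => tuple_map (fun e : {e | (v, e) \in I} =>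
    Vmaps_at (proj2_sig e))).

Definition Wspace_to_C1 : 'Hom(Wspace, C1 free_sheaf) :=
  tuple_map (fun e =>
    match boolP (e \in adapting_edges) with
    | AltTrue Ee => (to_free_estalk e \o Wspace_at Ee)%VF
    | AltFalse _ => 0
    end).

End Sheaf.

Lemma coboundaryE (R : realType) (G : graph) (o : orientation G) (F : sheaf R G) (z : C0 F) e :
  proj e (coboundary o F z) = restr F (head_end o e) (proj (ehead o e) z)
    - restr F (tail_end o e) (proj (etail o e) z).
Proof. by rewrite proj_tuple add_lfunE opp_lfunE !comp_lfunE. Qed.

Lemma restr_structureE (R : realType) (G : graph) (F : sheaf R G) (x : C0 F) v e
  (ve : v \in ends e) z : restr (structure_sheaf x) ve z =
  (proj (V := fun e : {e | v \in ends e} => hom_space (vstalk F v) (estalk F (sval e))) (exist _ e ve) z : 'Hom(_, _)) (proj v x).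
Proof. by rewrite [LHS]comp_lfunE eval_atE. Qed.

Lemma restr_freeE (R : realType) (G : graph) (F : sheaf R G) (x : C0 F) I v e
  (ve : v \in ends e) z : restr (free_sheaf x I) ve z =
  to_free_estalk F I e (restr (structure_sheaf x) ve (T_incl x I v z)).
Proof. by rewrite [LHS]comp_lfunE comp_lfunE. Qed.

(* The identifications Vmaps_to_C0 and Wspace_to_C1 are isometric isomorphisms. *)
Section Identification.
Variables (R : realType) (G : graph) (F : sheaf R G) (x : C0 F).
Variable (I : {set vert G * edge G}).

Lemma Vmaps_to_C0_isometry a b :
  inner _ (Vmaps_to_C0 x I a) (Vmaps_to_C0 x I b) = inner (Vmaps F I) a b.
Proof.
rewrite !innerE sum_sig (eq_bigr (fun v => \sum_(e : {e | (v, e) \in I})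
   inner _ (Vmaps_at F (proj2_sig e) a) (Vmaps_at F (proj2_sig e) b))).
  rewrite (eq_bigr _ (fun v _ => sum_sig _)).
  rewrite pair_big; apply: eq_bigr => -[v e] _ /=.
  by set q := boolP _; case: {-}_ / q.
by move=> v _; rewrite innerE; apply: eq_bigr => e _; rewrite !proj_tuple.
Qed.

Lemma to_free_estalk_isometry e u v : e \in adapting_edges I ->
  inner _ (to_free_estalk F I e u) (to_free_estalk F I e v) = inner _ u v.
Proof.
by rewrite /to_free_estalk /free_estalk => ->; rewrite !lfunE.
Qed.

Lemma to_free_estalkK e c :
  to_free_estalk F I e (adjoint (to_free_estalk F I e) c) = c.
Proof.
have H b (E : euclid R) (d : if b then E else zero_space) :
    let t := if b as b return 'Hom(E, if b then E else zero_space)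
             then \1%VF else 0 in t (adjoint t d) = d.
  case: b d => d /=; last by apply: dsumP; case.
  by rewrite lfunE; apply: inner_inj => u; rewrite adjointP lfunE.
exact: H.
Qed.

Lemma Wspace_to_C1_isometry a b :
  inner _ (Wspace_to_C1 x I a) (Wspace_to_C1 x I b) = inner (Wspace F I) a b.
Proof.
rewrite !innerE sum_sig; apply: eq_bigr => e _; rewrite !proj_tuple.
case: {-}_ / boolP => Ee; last by rewrite !zero_lfunE linear0r.
by rewrite !comp_lfunE to_free_estalk_isometry.
Qed.

Lemma Vmaps_to_C0_surj c : exists a, Vmaps_to_C0 x I a = c.
Proof.
pose f (i : {i | i \in I}) : hom_space (vstalk F (sval i).1) (estalk F (sval i).2) :=
  match i with
  | exist (v, e) ve => proj (exist (fun e => (v, e) \in I) e ve) (proj v c)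
  end.
exists (dsum_of f); apply: dsumP => v; apply: dsumP => -[e ve].
rewrite !tuple_mapE; transitivity (f (exist _ (v, e) ve)); last by rewrite /f !projE.
exact: (@proj_of R _ (fun i : {i | i \in I} =>
  hom_space (vstalk F (sval i).1) (estalk F (sval i).2)) f (exist _ (v, e) ve)).
Qed.

Lemma Wspace_to_C1_surj c : exists a, Wspace_to_C1 x I a = c.
Proof.
exists (dsum_of (fun e : {e | e \in adapting_edges I} =>
  adjoint (to_free_estalk F I (sval e)) (proj (sval e) c))).
apply: dsumP => e; rewrite !tuple_mapE.
case: {-}_ / boolP => Ee.
  by rewrite comp_lfunE /Wspace_at (proj_of _ (exist _ e Ee)) to_free_estalkK projE.
rewrite zero_lfunE;
  move: ((c : dsum_vect _) e) => /=; rewrite /free_estalk (negPf Ee) => d.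
by apply: dsumP; case.
Qed.

End Identification.

(* Main.v *)
Require Import Defs.
From mathcomp Require Import all_boot all_order all_algebra.
From mathcomp Require Import reals.
Import GRing.Theory.
Local Open Scope ring_scope.

(** Over an edge e, both the discrepancy operator and the discrepancy constant
    are signed sums over endpoints of e, the endpoint w contributing the value
    at x_w of a map on the incidence (w, e).  Since e has exactly two endpoints,
    of opposite signs, such a sum is a head term minus a tail term
    ([sum_incidence_sign]), which is the form of a coboundary.

    It remains to compare the terms at one endpoint.  Restricting a free
    structure evaluates its component at (w, e), which vanishes when (w, e) is
    not adapting ([restr_T_incl]); restricting the stubborn configuration does
    the same with the two cases exchanged ([restr_S_incl_fixed_maps]).  This
    gives the statements on the coboundary and on the constant.

    The Laplacian statement then holds because the identifications of the
    cochain spaces with Vmaps and Wspace are isometric isomorphisms: an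
    isometric change of coordinates that intertwines two operators also
    intertwines their Gram operators ([gram_intertwine]). *)

Section Gram.
Variables (R : realType) (U V U' V' : euclid R).

(** Both sides have the same inner products with every T b, since each of them
    reduces to the inner product of A a and A b; surjectivity of T makes these
    tests sufficient. *)
Lemma gram_intertwine (A : 'Hom(U, V)) (B : 'Hom(U', V'))
    (T : 'Hom(U, U')) (J : 'Hom(V, V')) :
    (forall a b, inner U' (T a) (T b) = inner U a b) ->
    (forall c, exists a, T a = c) ->
    (forall a b, inner V' (J a) (J b) = inner V a b) ->
    (B \o T = J \o A)%VF ->
  ((adjoint B \o B) \o T = T \o (adjoint A \o A))%VF.
Proof.
move=> T_iso T_surj J_iso BT.
have BTE a : B (T a) = J (A a) by rewrite -!comp_lfunE BT.
apply/lfunP => a; rewrite !comp_lfunE; apply: inner_inj => c.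
have [b <-] := T_surj c.
by rewrite adjointP !BTE J_iso T_iso adjointP.
Qed.

End Gram.

Section Signs.
Variables (R : realType) (G : graph) (o : orientation G).

Lemma ehead_neq_etail e : ehead o e != etail o e.
Proof.
by apply/eqP => ht; have := card_ends e; rewrite (endsE o) ht setUid cards1.
Qed.

(** The head term a and the tail term b are described by their values where f
    is defined and by their vanishing elsewhere, because the restriction maps
    they come from only make sense at an endpoint of e. *)
Lemma sum_incidence_sign (V : lmodType R) e (P : pred (vert G))
    (f : {w | P w} -> V) (a b : V) :
    (forall Ph : P (ehead o e), a = f (exist _ (ehead o e) Ph)) ->
    (~~ P (ehead o e) -> a = 0) ->
    (forall Pt : P (etail o e), b = f (exist _ (etail o e) Pt)) ->
    (~~ P (etail o e) -> b = 0) ->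
  \sum_(w : {w | P w}) incidence_sign R o (sval w) e *: f w = a - b.
Proof.
move=> aP a0 bP b0; rewrite sum_sig (bigD1 (ehead o e)) //=.
rewrite (bigD1 (etail o e)) /=; last by rewrite eq_sym ehead_neq_etail.
rewrite big1 ?addr0 => [|w /andP[/negPf wh /negPf wt]]; last first.
  by case: {-}_ / boolP => // Pw; rewrite /incidence_sign /= wh wt scale0r.
congr (_ + _).
  case: {-}_ / boolP => [Ph|/a0 -> //].
  by rewrite /incidence_sign /= eqxx scale1r -aP.
case: {-}_ / boolP => [Pt|/b0 ->]; last by rewrite oppr0.
rewrite /incidence_sign /= eq_sym (negPf (ehead_neq_etail e)) eqxx.
by rewrite scaleN1r -bP.
Qed.

End Signs.

Section Structures.
Variables (R : realType) (G : graph) (o : orientation G).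
Variables (F : sheaf R G) (x : C0 F) (I : {set vert G * edge G}).

Lemma proj_Vmaps_to_C0 v (e : {e | (v, e) \in I}) (a : Vmaps F I) :
  proj e (proj v (Vmaps_to_C0 x I a) : T_stalk F I v)
  = Vmaps_at F (proj2_sig e) a.
Proof. by rewrite [proj v _](proj_tuple (V := T_stalk F I)) proj_tuple. Qed.

Lemma restr_T_incl v e (ve : v \in ends e) (a : Vmaps F I) :
  restr (structure_sheaf x) ve (T_incl x I v (proj v (Vmaps_to_C0 x I a))) =
  match boolP ((v, e) \in I) with
  | AltTrue veI => (Vmaps_at F veI a : 'Hom(_, _)) (proj v x)
  | AltFalse _ => 0
  end.
Proof.
rewrite restr_structureE proj_tuple /=.
case: {-}_ / boolP => [veI|_]; last by rewrite !zero_lfunE.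
by congr (fun_of_lfun _ _); exact: (proj_Vmaps_to_C0 v (exist _ e veI) a).
Qed.

Lemma proj_fixed_maps v (e : {e | (v \in ends e) && ((v, e) \notin I)}) :
  proj e (proj v (fixed_maps F I)) = restr F (proj1 (andP (proj2_sig e))).
Proof. by rewrite /fixed_maps (proj_of (V := S_stalk F I)) proj_of. Qed.

Lemma restr_S_incl_fixed_maps v e (ve : v \in ends e) :
  restr (structure_sheaf x) ve (proj v (S_incl x I (fixed_maps F I))) =
  if (v, e) \notin I then restr F ve (proj v x) else 0.
Proof.
rewrite restr_structureE proj_tuple comp_lfunE proj_tuple /=.
case: {-}_ / boolP => [/= veS|]; last first.
  by rewrite /= ve /= => /negPf ->; rewrite !zero_lfunE.
have /andP[_ ->] := veS; have := proj_fixed_maps v (exist _ e veS).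
rewrite /= => ->; congr (fun_of_lfun (restr F _) _); exact: bool_irrelevance.
Qed.

Lemma proj_discrepancy_op (e : {e | e \in adapting_edges I}) (a : Vmaps F I) :
  proj e (discrepancy_op o x I a) =
  \sum_(w : {w | (w, sval e) \in I}) incidence_sign R o (sval w) (sval e) *:
    (Vmaps_at F (proj2_sig w) a : 'Hom(_, _)) (proj (sval w) x).
Proof.
rewrite [LHS](proj_tuple (V := fun e : {e | e \in adapting_edges I} => _)).
by rewrite sum_lfunE; apply: eq_bigr => w _; rewrite scale_lfunE comp_lfunE eval_atE.
Qed.

Lemma coboundary_free_sheaf :
  (coboundary o (free_sheaf x I) \o Vmaps_to_C0 x I)%VF
    = (Wspace_to_C1 x I \o discrepancy_op o x I)%VF.
Proof.
apply/lfunP => a; rewrite !comp_lfunE; apply: dsumP => e.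
rewrite -!projE [RHS](proj_tuple (V := free_estalk F I)) coboundaryE.
rewrite !restr_freeE.
case: {-}_ / boolP => Ee; last first.
  (* A non-adapting edge has the zero stalk, so both sides vanish. *)
  rewrite zero_lfunE; suff -> : to_free_estalk F I e = 0.
    by rewrite !zero_lfunE subrr.
  rewrite /to_free_estalk /free_estalk.
  by move: Ee; case: (e \in adapting_edges I).
rewrite comp_lfunE -linearB; congr (fun_of_lfun (to_free_estalk F I e) _).
rewrite [RHS](proj_discrepancy_op (exist _ e Ee)) !restr_T_incl; apply/esym.
apply: (@sum_incidence_sign R G o _ e (fun w => (w, e) \in I)
  (fun w => (Vmaps_at F (proj2_sig w) a : 'Hom(_, _)) (proj (sval w) x))).
- move=> Ph; case: {-}_ / boolP => [Ph'|/negP//].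
  by rewrite (bool_irrelevance Ph' Ph).
- by move=> /negP nP; case: {-}_ / boolP.
- move=> Pt; case: {-}_ / boolP => [Pt'|/negP//].
  by rewrite (bool_irrelevance Pt' Pt).
- by move=> /negP nP; case: {-}_ / boolP.
Qed.

Lemma discrepancy_const_coboundary (e : {e | e \in adapting_edges I}) :
  proj e (discrepancy_const o x I)
  = proj (sval e)
      (coboundary o (structure_sheaf x) (S_incl x I (fixed_maps F I))).
Proof.
rewrite coboundaryE !restr_S_incl_fixed_maps proj_of big_mkcond /=.
pose f (w : {w | w \in ends (sval e)}) : estalk F (sval e) :=
  if (sval w, sval e) \notin I then restr F (proj2_sig w) (proj (sval w) x) else 0.
rewrite (eq_bigr (fun w => incidence_sign R o (sval w) (sval e) *: f w)) => [|w _].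
  apply: sum_incidence_sign; rewrite ?head_end ?tail_end // => we.
    by rewrite /f /= (bool_irrelevance we (head_end _ _)).
  by rewrite /f /= (bool_irrelevance we (tail_end _ _)).
by rewrite /f; case: ifP => // _; rewrite scaler0.
Qed.

End Structures.

Theorem proposition4p8 (R : realType) (G : graph) (o : orientation G)
    (F : sheaf R G) (x : C0 F) (I : {set vert G * edge G})
    (hI : forall v e, (v, e) \in I -> v \in ends e) :
  [/\ (coboundary o (free_sheaf x I) \o Vmaps_to_C0 x I)%VF
        = (Wspace_to_C1 x I \o discrepancy_op o x I)%VF,
      (laplacian o (free_sheaf x I) \o Vmaps_to_C0 x I)%VF
        = (Vmaps_to_C0 x I \o
             (adjoint (discrepancy_op o x I) \o discrepancy_op o x I))%VF
    & forall e : {e | e \in adapting_edges I},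
        proj e (discrepancy_const o x I)
        = proj (sval e)
            (coboundary o (structure_sheaf x) (S_incl x I (fixed_maps F I)))].
Proof.
split; [exact: coboundary_free_sheaf | | exact: discrepancy_const_coboundary].
apply: (gram_intertwine _ _ _ _ _ _ _ _ _ _ _ _ (coboundary_free_sheaf _ _ o _ x I)).
- exact: Vmaps_to_C0_isometry.
- exact: Vmaps_to_C0_surj.
- exact: Wspace_to_C1_isometry.
Qed.
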